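(* Let $\mathbb{K}$ be a field. The graded vector subspace of $\mathrm{ParQSym}$ spanned by the $M_\pi$ with $\pi$ a planar diagram is a Hopf subalgebra of $\mathrm{ParQSym}$.
   Context: **Partition diagrams.** A partition diagram of order $k\ge 0$ is a set partition of $\{1,\dots,k,1',\dots,k'\}$; for $k=0$ the only one is the empty diagram $\emptyset$. It is drawn as a graph with $1,\dots,k$ in an upper row and $1',\dots,k'$ in a lower row (left to right) whose connected components are the blocks. For $\pi$ of order $k$ and $\rho$ of order $m$, $\pi\otimes\rho$ is the diagram of order $k+m$ whose blocks are the blocks of $\pi$ and the blocks of $\rho$ with labels shifted by $k$ ($i\mapsto i+k$, $i'\mapsto (i+k)'$). If $k,m\ge1$, $\pi\bullet\rho$ is obtained from $\pi\otimes\rho$ by merging the block containing $k'$ with the block containing $(k+1)'$. The empty diagram is the unit for both operations. A diagram is $\otimes$-irreducible if it is not of the form $\rho\otimes\sigma$ with $\rho,\sigma$ both non-empty (so $\emptyset$ is $\otimes$-irreducible). Every non-empty $\pi$ is uniquely $\pi_1\otimes\cdots\otimes\pi_l$ with all $\pi_i$ non-empty and $\otimes$-irreducible. A partition diagram is planar if it can be represented by such a two-row graph drawn without edge crossings inside the rectangle bounded by the two rows; equivalently, it is a non-crossing set partition with respect to the cyclic order $1,2,\dots,k,k',\dots,2',1'$. The empty diagram is planar. **ParQSym.** $\mathrm{ParQSym}=\bigoplus_{i\ge0}\mathrm{ParQSym}_i$, where $\mathrm{ParQSym}_i$ is the $\mathbb{K}$-vector space with basis $\{M_\pi:\pi\text{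 of order }i\}$. Coproduct: $\Delta M_\sigma=\sum_{\pi\otimes\rho=\sigma}M_\pi\otimes M_\rho$, over all ordered pairs of (possibly empty) diagrams with $\pi\otimes\rho=\sigma$. Counit: $\varepsilon(M_\pi)=\delta_{\pi,\emptyset}$. Product: $M_\emptyset$ is the unit; for non-empty $\rho=\rho_1\otimes\cdots\otimes\rho_n$, $\sigma=\sigma_1\otimes\cdots\otimes\sigma_m$ with all $\rho_i,\sigma_j$ non-empty $\otimes$-irreducible, $$M_\rho\star M_\sigma=\sum M_{(\rho'_1\bullet\sigma'_1)\otimes\cdots\otimes(\rho'_k\bullet\sigma'_k)},$$ over all $k\in\mathbb{N}$ and all pairs of sequences of diagrams $(\rho'_1,\dots,\rho'_k)$, $(\sigma'_1,\dots,\sigma'_k)$ that become $(\rho_1,\dots,\rho_n)$, respectively $(\sigma_1,\dots,\sigma_m)$, after deleting all empty diagrams, and such that $\rho'_s\bullet\sigma'_s\ne\emptyset$ for all $1\le s\le k$. With these operations $\mathrm{ParQSym}$ is a connected graded bialgebra, hence a Hopf algebra. *)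

(* Defs.v *)
From HB Require Import structures.
From mathcomp Require Import all_boot all_order all_algebra.
From mathcomp Require Export freeg.

Set Implicit Arguments.
Unset Strict Implicit.
Unset Printing Implicit Defensive.

Import GRing.Theory.
Local Open Scope ring_scope.

(* [inl i] is the upper vertex i+1 and [inr i] the lower vertex (i+1)'. *)
Definition vertex (k : nat) : finType := ('I_k + 'I_k)%type.

Definition diagram (k : nat) : finType :=
  {P : {set {set vertex k}} | partition P [set: vertex k]}.

Definition pdiagram : choiceType := {k : nat & diagram k}.

Definition pdiag k (P : diagram k) : pdiagram := Tagged diagram P.

Definition diag_order (p : pdiagram) : nat := tag p.

Lemma empty_partition : partition set0 [set: vertex 0].
Proof.
suff -> : [set: vertex 0] = set0.
  by apply/and3P; split; rewrite ?inE // /cover ?big_set0 // /trivIset /cover !big_set0 cards0.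
by apply/setP; case=> [[]|[]].
Qed.

Definition empty_diagram : pdiagram := pdiag (exist _ set0 empty_partition).

Section Embeddings.
Variables k m : nat.

Definition lemb (x : vertex k) : vertex (k + m) :=
  match x with inl i => inl (lshift m i) | inr i => inr (lshift m i) end.

Definition remb (x : vertex m) : vertex (k + m) :=
  match x with inl i => inl (rshift k i) | inr i => inr (rshift k i) end.

Lemma lemb_inj : injective lemb.
Proof. by move=> [i|i] [j|j] //= [] /val_inj ->. Qed.

Lemma remb_inj : injective remb.
Proof. by move=> [i|i] [j|j] //= [] /addnI /val_inj ->. Qed.

Lemma lemb_remb x y : lemb x != remb y.
Proof.
case: x y => [i|i] [j|j] //; apply/eqP => -[] /eqP;
  by rewrite eqn_leq [X in _ && X]leqNgt ltn_addr ?andbF.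
Qed.

Definition tensor_blocks (P : {set {set vertex k}}) (Q : {set {set vertex m}}) :
    {set {set vertex (k + m)}} :=
  [set lemb @: (B : {set vertex k}) | B in P]
    :|: [set remb @: (B : {set vertex m}) | B in Q].

Lemma tensor_partition (P : diagram k) (Q : diagram m) :
  partition (tensor_blocks (val P) (val Q)) [set: vertex (k + m)].
Proof.
case: P Q => P /= /and3P[/eqP cP tP nP] [Q /= /and3P[/eqP cQ tQ nQ]].
apply/and3P; split.
- apply/eqP/setP => x; rewrite inE; apply/bigcupP.
  have inP y : y \in cover P by rewrite cP inE.
  have inQ y : y \in cover Q by rewrite cQ inE.
  case: x => i; case: (split_ordP i) => j ->.
  + have /bigcupP[B BP jB] := inP (inl j); exists (lemb @: B).
      by rewrite inE imset_f.
    by apply/imsetP; exists (inl j).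
  + have /bigcupP[B BP jB] := inQ (inl j); exists (remb @: B).
      by rewrite inE imset_f ?orbT.
    by apply/imsetP; exists (inl j).
  + have /bigcupP[B BP jB] := inP (inr j); exists (lemb @: B).
      by rewrite inE imset_f.
    by apply/imsetP; exists (inr j).
  + have /bigcupP[B BP jB] := inQ (inr j); exists (remb @: B).
      by rewrite inE imset_f ?orbT.
    by apply/imsetP; exists (inr j).
- apply/trivIsetP => A B /setUP[] /imsetP[A' A'P ->] /setUP[] /imsetP[B' B'P ->] neq.
  + rewrite imset_disjoint; last exact: lemb_inj.
    by apply: (trivIsetP tP) => //; apply: contra neq => /eqP ->.
  + rewrite -setI_eq0; apply/eqP/setP => x; rewrite !inE; apply/andP.
    case=> /imsetP[a _ ->] /imsetP[b _ /eqP]; by rewrite (negPf (lemb_remb _ _)).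
  + rewrite -setI_eq0; apply/eqP/setP => x; rewrite !inE; apply/andP.
    case=> /imsetP[a _ ->] /imsetP[b _ /esym/eqP]; by rewrite (negPf (lemb_remb _ _)).
  + rewrite imset_disjoint; last exact: remb_inj.
    by apply: (trivIsetP tQ) => //; apply: contra neq => /eqP ->.
- rewrite inE; apply/norP; split; apply/imsetP => -[B BP /esym/eqP];
    by rewrite imset_eq0 => /eqP B0; move: BP; rewrite B0 ?(negPf nP) ?(negPf nQ).
Qed.

Definition tensor_diagram (P : diagram k) (Q : diagram m) : diagram (k + m) :=
  exist _ (tensor_blocks (val P) (val Q)) (tensor_partition P Q).

End Embeddings.

Definition otimes (p q : pdiagram) : pdiagram :=
  pdiag (tensor_diagram (tagged p) (tagged q)).

Definition merge_blocks (T : finType) (P : {set {set T}}) (x y : T) : {set {set T}} :=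
  (pblock P x :|: pblock P y) |: ((P :\ pblock P x) :\ pblock P y).

Lemma merge_partition (T : finType) (P : {set {set T}}) (x y : T) :
  partition P [set: T] -> partition (merge_blocks P x y) [set: T].
Proof.
move=> /and3P[/eqP cP tP nP].
have inP z : z \in cover P by rewrite cP inE.
have bP z : pblock P z \in P by apply: pblock_mem.
have in_b z : z \in pblock P z by rewrite mem_pblock.
apply/and3P; split.
- apply/eqP/setP => z; rewrite inE; apply/bigcupP.
  have [e|nx] := eqVneq (pblock P z) (pblock P x).
    by exists (pblock P x :|: pblock P y); rewrite ?setU11 // inE -e in_b.
  have [e|ny] := eqVneq (pblock P z) (pblock P y).
    by exists (pblock P x :|: pblock P y); rewrite ?setU11 // inE -e in_b orbT.
  by exists (pblock P z) => //; rewrite !inE nx ny bP orbT.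
- have dis B : B \in (P :\ pblock P x) :\ pblock P y ->
      [disjoint pblock P x :|: pblock P y & B].
    rewrite !inE => /and3P[By Bx BP].
    rewrite -setI_eq0 setIUl setU_eq0 !setI_eq0.
    by rewrite !(trivIsetP tP) // eq_sym.
  apply/trivIsetP => A B /setU1P[->|AP] /setU1P[->|BP] neq.
  + by rewrite eqxx in neq.
  + exact: dis.
  + by rewrite disjoint_sym; apply: dis.
  + by move: AP BP; rewrite !inE => /and3P[_ _ ?] /and3P[_ _ ?]; apply: (trivIsetP tP).
- rewrite !inE (negPf nP) !andbF orbF eq_sym; apply/set0Pn; exists x.
  by rewrite inE in_b.
Qed.

(* Merges the block of k' with the block of (k+1)' in the tensor product of a
   diagram of order k = k0+1 and a diagram of order m = m0+1. *)
Definition bullet_diagram k0 m0 (P : diagram k0.+1) (Q : diagram m0.+1) :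
    diagram (k0.+1 + m0.+1) :=
  let k' : vertex (k0.+1 + m0.+1) := inr (lshift m0.+1 ord_max) in
  let k1' : vertex (k0.+1 + m0.+1) := inr (rshift k0.+1 ord0) in
  exist _ (merge_blocks (tensor_blocks (val P) (val Q)) k' k1')
          (merge_partition k' k1' (tensor_partition P Q)).

Definition bullet (p q : pdiagram) : pdiagram :=
  match p, q with
  | existT 0 _, _ => q
  | _, existT 0 _ => p
  | existT k0.+1 P, existT m0.+1 Q => pdiag (bullet_diagram P Q)
  end.

Definition tensor_seq (s : seq pdiagram) : pdiagram := foldr otimes empty_diagram s.

Definition diagrams_upto (n : nat) : seq pdiagram :=
  [seq pdiag P | k <- iota 0 n.+1, P <- enum (diagram k)].

(* All ordered pairs (p, q) with p (x) q = s, each listed once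
   (see [mem_splittings] and [splittings_uniq]). *)
Definition splittings (s : pdiagram) : seq (pdiagram * pdiagram) :=
  [seq pq <- [seq (p, q) | p <- diagrams_upto (diag_order s), q <- diagrams_upto (diag_order s)]
  | otimes pq.1 pq.2 == s].

Lemma mem_diagrams_upto n p : (p \in diagrams_upto n) = (diag_order p <= n)%N.
Proof.
apply/idP/idP.
  by case/allpairsPdep => k [P [+ _ ->]]; rewrite mem_iota.
case: p => k P /= le_kn; apply/allpairsPdep; exists k, P.
by rewrite mem_iota mem_enum.
Qed.

Lemma diagrams_upto_uniq n : uniq (diagrams_upto n).
Proof.
apply: allpairs_uniq_dep => [|k _|]; rewrite ?iota_uniq ?enum_uniq //.
by move=> [k P] [m Q] _ _.
Qed.

Lemma mem_splittings s p q : ((p, q) \in splittings s) = (otimes p q == s).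
Proof.
rewrite mem_filter /=; case: eqP => //= <-.
by apply/allpairsP; exists (p, q); rewrite !mem_diagrams_upto leq_addr leq_addl.
Qed.

Lemma splittings_uniq s : uniq (splittings s).
Proof.
by rewrite filter_uniq // allpairs_uniq ?diagrams_upto_uniq // => -[? ?] [? ?].
Qed.

Definition tensor_irreducible (p : pdiagram) : bool :=
  all (fun qr => (qr.1 == empty_diagram) || (qr.2 == empty_diagram)) (splittings p).

Lemma tensor_irreducibleP p :
  reflect (~ exists q r, [/\ p = otimes q r, q <> empty_diagram & r <> empty_diagram])
          (tensor_irreducible p).
Proof.
apply: (iffP allP) => [irr [q [r [epqr q0 r0]]]|irr [q r]].
  have := irr (q, r); rewrite mem_splittings epqr eqxx => /(_ isT)/=.
  by case/orP=> /eqP.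
rewrite mem_splittings /= => /eqP e; apply: contra_notT irr => /norP[/eqP q0 /eqP r0].
by exists q, r.
Qed.

Definition is_factorization (p : pdiagram) (s : seq pdiagram) : bool :=
  all (fun q => (q != empty_diagram) && tensor_irreducible q) s && (tensor_seq s == p).

Definition castv k m (e : k = m) (x : vertex k) : vertex m :=
  match x with inl i => inl (cast_ord e i) | inr i => inr (cast_ord e i) end.

Lemma pdiag_eq k m (e : k = m) (P : diagram k) (Q : diagram m) :
  [set castv e @: (B : {set vertex k}) | B in val P] = val Q -> pdiag P = pdiag Q.
Proof.
case: m / e Q => Q ePQ; congr pdiag; apply: val_inj; rewrite -ePQ.
have castv_id x : castv (erefl k) x = x by case: x => i /=; rewrite cast_ord_id.
under eq_imset => B do rewrite (eq_imset _ castv_id) imset_id.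
by rewrite imset_id.
Qed.

Lemma otimesA : associative otimes.
Proof.
move=> [k P] [m Q] [n R]; apply: (pdiag_eq (e := addnA k m n)) => /=.
rewrite /tensor_blocks !imsetU -!imset_comp setUA.
congr (_ :|: _ :|: _); apply: eq_imset => B /=; rewrite -!imset_comp;
  apply: eq_imset => -[i|i] /=; congr (_ _); apply: val_inj => //=; exact: addnA.
Qed.

Lemma order0P p : diag_order p = 0 -> p = empty_diagram.
Proof.
case: p => k P /= k0; subst k; congr pdiag; apply: val_inj; case: P => /= P.
case/and3P=> _ _ P0; apply/setP => B; rewrite in_set0; apply: contraNF P0.
by suff -> : B = set0 by []; apply/setP; case=> [[]|[]].
Qed.

Lemma otimes0p : left_id empty_diagram otimes.
Proof.
move=> [k P]; apply: (pdiag_eq (e := add0n k)) => /=.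
rewrite /tensor_blocks imset0 set0U -imset_comp -[RHS]imset_id.
apply: eq_imset => B /=; rewrite -imset_comp -[RHS]imset_id.
by apply: eq_imset => -[i|i] /=; congr (_ _); apply: val_inj.
Qed.

Lemma otimesp0 : right_id empty_diagram otimes.
Proof.
move=> [k P]; apply: (pdiag_eq (e := addn0 k)) => /=.
rewrite /tensor_blocks imset0 setU0 -imset_comp -[RHS]imset_id.
apply: eq_imset => B /=; rewrite -imset_comp -[RHS]imset_id.
by apply: eq_imset => -[i|i] /=; congr (_ _); apply: val_inj.
Qed.

Lemma tensor_seq_cat s t : tensor_seq (s ++ t) = otimes (tensor_seq s) (tensor_seq t).
Proof. by elim: s => [|p s IHs] /=; rewrite ?otimes0p // IHs otimesA. Qed.

Lemma factorization_exists p : exists s, is_factorization p s.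
Proof.
have [n] := ubnP (diag_order p); elim: n p => // n IHn p; rewrite ltnS => le_pn.
have [->|p0] := eqVneq p empty_diagram; first by exists [::]; rewrite /is_factorization /=.
have [irr|] := boolP (tensor_irreducible p).
  by exists [:: p]; rewrite /is_factorization /= p0 irr otimesp0 eqxx.
case/allPn => -[q r]; rewrite mem_splittings /= => /eqP epqr /norP[q0 r0].
have order_gt0 t : t != empty_diagram -> (0 < diag_order t)%N.
  by rewrite lt0n; apply: contraNneq => /order0P ->.
have eo : diag_order p = (diag_order q + diag_order r)%N by rewrite -epqr.
have [|s /andP[As /eqP es]] := IHn q.
  by apply: leq_trans le_pn; rewrite eo -[X in (X < _)%N]addn0 ltn_add2l order_gt0.
have [|t /andP[At /eqP et]] := IHn r.
  by apply: leq_trans le_pn; rewrite eo -[X in (X < _)%N]add0n ltn_add2r order_gt0.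
by exists (s ++ t); rewrite /is_factorization all_cat As At tensor_seq_cat es et epqr /=.
Qed.

(* The factorization p = p_1 (x) ... (x) p_l into non-empty irreducible diagrams,
   which is unique; it is [::] for the empty diagram. *)
Definition factors (p : pdiagram) : seq pdiagram := xchoose (factorization_exists p).

Definition strip (s : seq pdiagram) : seq pdiagram :=
  [seq p <- s | p != empty_diagram].

(* All sequences of length k that become s after deleting all empty diagrams,
   each listed once (see [mem_paddings] and [paddings_uniq]). *)
Definition paddings (k : nat) (s : seq pdiagram) : seq (seq pdiagram) :=
  [seq t <- [seq map val (tval u) | u : k.-tuple (seq_sub (empty_diagram :: s))]
  | strip t == s].

Lemma mem_paddings k s t : (t \in paddings k s) = (strip t == s) && (size t == k).
Proof.
rewrite mem_filter; case: eqP => //= est; apply/imageP/eqP.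
  by case=> u _ ->; rewrite size_map size_tuple.
move=> st; have sub p : p \in t -> p \in empty_diagram :: s.
  by rewrite inE -est mem_filter => ->; rewrite andbT orbN.
pose u := pmap (insub : pdiagram -> option (seq_sub (empty_diagram :: s))) t.
have eu : map val u = t.
  rewrite /u (pmap_filter (insubK _)); apply/all_filterP/allP => p pt.
  by rewrite /= insubT ?sub.
have su : size u == k by rewrite -(size_map val) eu st.
by exists (Tuple su) => //=.
Qed.

Lemma paddings_uniq k s : uniq (paddings k s).
Proof.
rewrite filter_uniq // map_inj_uniq ?enum_uniq // => u v /(inj_map val_inj) ?.
exact: val_inj.
Qed.

Definition bullet_seq (r s : seq pdiagram) : seq pdiagram :=
  [seq bullet ab.1 ab.2 | ab <- zip r s].

Definition cyclic_pos k (x : vertex k) : nat :=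
  match x with inl i => i : nat | inr i => (k + rev_ord i)%N end.

(* Non-crossing for the cyclic order 1, ..., k, k', ..., 1'. Cutting the circle
   before 1 and letting A, B range over ordered pairs of distinct blocks covers
   all the cyclic patterns a < b < c < d. *)
Definition planar (p : pdiagram) : Prop :=
  forall A B : {set vertex (diag_order p)},
    A \in val (tagged p) -> B \in val (tagged p) -> A != B ->
  forall a b c d, a \in A -> b \in B -> c \in A -> d \in B ->
    ~ [/\ (cyclic_pos a < cyclic_pos b)%N, (cyclic_pos b < cyclic_pos c)%N
        & (cyclic_pos c < cyclic_pos d)%N].

Definition linear_span (K : fieldType) (V : lmodType K) (A : V -> Prop) (v : V) : Prop :=
  exists s : seq (K * V),
    (forall cu, cu \in s -> A cu.2) /\ v = \sum_(cu <- s) cu.1 *: cu.2.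

Section ParQSym.
Variable K : fieldType.

Definition ParQSym := {freeg pdiagram / K}.

(* ParQSym tensored with itself; << (p, q) >> is M_p tensor M_q. *)
Definition ParQSym2 := {freeg (pdiagram * pdiagram)%type / K}.

Definition Mdiag (p : pdiagram) : ParQSym := << p >>.

Definition tens (x y : ParQSym) : ParQSym2 :=
  fglift (fun p => fglift (fun q => << (p, q) >> : ParQSym2) y) x.

(* The range of k is exhaustive: if k > n + m then some position
   carries the empty diagram in both sequences. *)
Definition starM (p q : pdiagram) : ParQSym :=
  if p == empty_diagram then Mdiag q else
  if q == empty_diagram then Mdiag p else
  \sum_(k < (size (factors p) + size (factors q)).+1)
    \sum_(r <- paddings k (factors p))
      \sum_(s <- paddings k (factors q) | empty_diagram \notin bullet_seq r s)
        Mdiag (tensor_seq (bullet_seq r s)).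

Definition star (x y : ParQSym) : ParQSym :=
  fglift (fun p => fglift (fun q => starM p q) y) x.

Definition unit_elt : ParQSym := Mdiag empty_diagram.

Definition coprod (x : ParQSym) : ParQSym2 :=
  fglift (fun s => \sum_(pq <- splittings s) (<< pq >> : ParQSym2)) x.

Definition counit (x : ParQSym) : K :=
  fglift (fun p => (p == empty_diagram)%:R : K^o) x.

(* The convolution product: the composite of [coprod], f tensor g, and [star]. *)
Definition convolution (f g : ParQSym -> ParQSym) (x : ParQSym) : ParQSym :=
  fglift (fun pq => star (f (Mdiag pq.1)) (g (Mdiag pq.2))) (coprod x).

Definition is_antipode (S : {linear ParQSym -> ParQSym}) : Prop :=
  forall x, convolution S id x = counit x *: unit_elt /\ convolution id S x = counit x *: unit_elt.

Definition homogeneous_component (i : nat) (x : ParQSym) : ParQSym :=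
  fglift (fun p => if diag_order p == i then Mdiag p else 0) x.

Definition graded_subspace (H : ParQSym -> Prop) : Prop :=
  [/\ H 0, forall (c : K) x y, H x -> H y -> H (c *: x + y)
    & forall i x, H x -> H (homogeneous_component i x)].

Definition subalgebra (H : ParQSym -> Prop) : Prop :=
  H unit_elt /\ forall x y, H x -> H y -> H (star x y).

(* coprod H is contained in the image of H tensor H. *)
Definition subcoalgebra (H : ParQSym -> Prop) : Prop :=
  forall x, H x ->
    linear_span (fun z => exists a b, [/\ H a, H b & z = tens a b]) (coprod x).

(* ParQSym is a connected graded bialgebra, so it has exactly one antipode. *)
Definition antipode_stable (H : ParQSym -> Prop) : Prop :=
  forall S : {linear ParQSym -> ParQSym}, is_antipode S -> forall x, H x -> H (S x).

Definition graded_Hopf_subalgebra (H : ParQSym -> Prop) : Prop :=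
  [/\ graded_subspace H, subalgebra H, subcoalgebra H & antipode_stable H].

Definition planar_span : ParQSym -> Prop :=
  linear_span (fun x => exists p, planar p /\ x = Mdiag p).

End ParQSym.

(* Main.v *)
Require Import Defs.
From mathcomp Require Import all_boot all_order all_algebra.
From mathcomp Require Import zify.

(** The planar diagrams are closed under [otimes] and [bullet], and a tensor product
    is planar only if both factors are: in the cyclic order the vertices of the right
    factor form an interval surrounded by those of the left one, and [bullet] merges
    the blocks of two cyclically adjacent vertices. Hence the span is closed
    under the product and the coproduct. Stability under an antipode [S] follows by
    induction on the order from
    [S M_p = eps M_p *: 1 - \sum_(p = q (x) r, r nonempty) S M_q * M_r]. *)

Set Implicit Arguments.
Unset Strict Implicit.
Unset Printing Implicit Defensive.

Import GRing.Theory.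
Local Open Scope ring_scope.

(** * Non-crossing partitions and merging the blocks of two neighbouring points *)

Lemma merge_blocksC (T : finType) (P : {set {set T}}) x y :
  merge_blocks P x y = merge_blocks P y x.
Proof.
rewrite /merge_blocks [pblock P x :|: _]setUC; congr (_ |: _).
by rewrite !setDDl setUC.
Qed.

Section Noncrossing.
Variables (T : finType) (f : T -> nat).
Implicit Types (P : {set {set T}}) (A B : {set T}).

(** Stated for an arbitrary labelling [f], so that merging is treated apart from diagrams; for
    [f := @cyclic_pos k] it is [planar] up to conversion. *)
Definition noncrossing P : Prop :=
  forall A B, A \in P -> B \in P -> A != B ->
  forall a b c d, a \in A -> b \in B -> c \in A -> d \in B ->
    ~ [/\ (f a < f b)%N, (f b < f c)%N & (f c < f d)%N].

(** No value of [f] lies strictly between [f x] and [f y], so each point of a third block has [x]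
    and [y] on the same side. A crossing of the merged block with a third block therefore yields one
    of [pblock P x] or [pblock P y] alone. *)
Lemma noncrossing_merge P x y : injective f -> f y = (f x).+1 ->
  partition P [set: T] -> noncrossing P -> noncrossing (merge_blocks P x y).
Proof.
move=> f_inj fxy /and3P[/eqP cP tP _] ncP.
have inP z : z \in cover P by rewrite cP inE.
have XP : pblock P x \in P by apply: pblock_mem.
have YP : pblock P y \in P by apply: pblock_mem.
have xX : x \in pblock P x by rewrite mem_pblock.
have yY : y \in pblock P y by rewrite mem_pblock.
set X := pblock P x in XP xX *; set Y := pblock P y in YP yY *.
(* A gap of a block other than X and Y contains x iff it contains y. *)
have sep B z : B \in P -> B != X -> B != Y -> z \in B ->
    (f z < f x /\ f z < f y)%N \/ (f x < f z /\ f y < f z)%N.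
  move=> BP BX BY zB; have nfx : f z != f x.
    by apply: contra_neq BX => /f_inj zE; rewrite /X -zE (def_pblock tP BP zB).
  have : f z != f y.
    by apply: contra_neq BY => /f_inj zE; rewrite /Y -zE (def_pblock tP BP zB).
  by case: (ltngtP (f z) (f x)) nfx => // zx _ nfy; [left|right]; move: nfy zx;
    clear -fxy; lia.
move=> A B /setU1P[-> BM neqAB|AM BM neqAB]; last first.
  case/setD1P: AM => AY /setD1P[AX AP]; case/setU1P: BM => [->|]; last first.
    by move=> /setD1P[BY /setD1P[BX BP]]; apply: ncP.
  have nXA := ncP X A XP AP; have nAX := ncP A X AP XP.
  have nYA := ncP Y A YP AP; have nAY := ncP A Y AP YP.
  rewrite eq_sym in nXA; rewrite eq_sym in nYA.
  (* When [b] and [d] come from different halves: if [x], [y] precede [a], the one in the half of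
     [b] is a new first point and [d] is dropped; if they follow [c], it replaces [d]; if they lie
     between, the one in the half of [d] replaces [b]. *)
  move=> a b c d aA /setUP[bX|bY] cA /setUP[dX|dY] [ab bc cd].
  - by apply: (nAX AX a b c d).
  - have [[ax ay]|[xa ya]] := sep A a AP AX AY aA; last by apply: (nXA AX x a b c).
    have [[cx cy]|[xc yc]] := sep A c AP AX AY cA; first by apply: (nAX AX a b c x).
    by apply: (nAY AY a y c d).
  - have [[ax ay]|[xa ya]] := sep A a AP AX AY aA; last by apply: (nYA AY y a b c).
    have [[cx cy]|[xc yc]] := sep A c AP AX AY cA; first by apply: (nAY AY a b c y).
    by apply: (nAX AX a x c d).
  - by apply: (nAY AY a b c d).
case/setU1P: BM neqAB => [->|/setD1P[BY /setD1P[BX BP]] _]; first by rewrite eqxx.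
have nXB := ncP X B XP BP; have nBX := ncP B X BP XP.
have nYB := ncP Y B YP BP; have nBY := ncP B Y BP YP.
rewrite eq_sym in nXB; rewrite eq_sym in nYB.
(* The mirror case: before [b], one of [x], [y] replaces [a]; between [b] and [d], one replaces [c];
   after [d], one is a new last point and [a] is dropped. *)
move=> a b c d /setUP[aX|aY] bB /setUP[cX|cY] dB [ab bc cd].
- by apply: (nXB BX a b c d).
- have [[bx by_]|[xb yb]] := sep B b BP BX BY bB; last by apply: (nYB BY y b c d).
  have [[dx dy]|[xd yd]] := sep B d BP BX BY dB; first by apply: (nBY BY b c d y).
  by apply: (nXB BX a b x d).
- have [[bx by_]|[xb yb]] := sep B b BP BX BY bB; last by apply: (nXB BX x b c d).
  have [[dx dy]|[xd yd]] := sep B d BP BX BY dB; first by apply: (nBX BX b c d x).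
  by apply: (nYB BY a b y d).
- by apply: (nYB BY a b c d).
Qed.

End Noncrossing.

(** * Cyclic positions in a tensor product *)

Lemma cyclic_pos_inj k : injective (@cyclic_pos k).
Proof.
move=> [i|i] [j|j] /= e; have := ltn_ord i; have := ltn_ord j; try lia.
  by move=> _ _; congr inl; apply: val_inj.
by move=> ? ?; congr inr; apply: val_inj => /=; lia.
Qed.

(** The [m.*2] right vertices are inserted directly after the [k] upper left ones, which pushes only
    the lower left ones. *)
Lemma cyclic_pos_lemb k m (x : vertex k) :
  cyclic_pos (lemb m x) =
    if (cyclic_pos x < k)%N then cyclic_pos x else (cyclic_pos x + m.*2)%N.
Proof.
by case: x => i /=; rewrite ?ltn_ord // ltnNge leq_addr /=; have := ltn_ord i; lia.
Qed.

Lemma cyclic_pos_remb k m (x : vertex m) :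
  cyclic_pos (remb k x) = (k + cyclic_pos x)%N.
Proof. by case: x => i //=; have := ltn_ord i; lia. Qed.

Lemma ltn_cyclic_pos k (x : vertex k) : (cyclic_pos x < k.*2)%N.
Proof. by case: x => i /=; have := ltn_ord i; lia. Qed.

(** [lemb] is no translation of positions, but it only opens one gap; the order survives, so
    crossings transfer in both directions. *)
Lemma ltn_cyclic_pos_lemb k m (x y : vertex k) :
  (cyclic_pos (lemb m x) < cyclic_pos (lemb m y))%N = (cyclic_pos x < cyclic_pos y)%N.
Proof.
rewrite !cyclic_pos_lemb.
by case: (ltnP (cyclic_pos x) k); case: (ltnP (cyclic_pos y) k); lia.
Qed.

Lemma ltn_cyclic_pos_remb k m (x y : vertex m) :
  (cyclic_pos (remb k x) < cyclic_pos (remb k y))%N = (cyclic_pos x < cyclic_pos y)%N.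
Proof. by rewrite !cyclic_pos_remb ltn_add2l. Qed.

Lemma cyclic_pos_lemb_remb k m (x : vertex k) (y : vertex m) :
  (cyclic_pos (lemb m x) < cyclic_pos (remb k y))%N -> (cyclic_pos (lemb m x) < k)%N.
Proof.
have := ltn_cyclic_pos y; rewrite cyclic_pos_lemb cyclic_pos_remb; case: (ltnP _ k); lia.
Qed.

Lemma cyclic_pos_remb_lemb k m (x : vertex k) (y : vertex m) :
  (cyclic_pos (remb k y) < cyclic_pos (lemb m x))%N ->
  (k + m.*2 <= cyclic_pos (lemb m x))%N.
Proof.
have := ltn_cyclic_pos y; rewrite cyclic_pos_lemb cyclic_pos_remb; case: (ltnP _ k); lia.
Qed.

Section TensorPlanar.
Variables (k m : nat) (P : {set {set vertex k}}) (Q : {set {set vertex m}}).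

Lemma noncrossing_tensor :
  noncrossing (@cyclic_pos k) P -> noncrossing (@cyclic_pos m) Q ->
  noncrossing (@cyclic_pos (k + m)) (tensor_blocks P Q).
Proof.
move=> ncP ncQ A B; rewrite !inE.
case/orP=> /imsetP[A' A'P ->] /orP[] /imsetP[B' B'P ->] neq a b c d
  /imsetP[a' a'A ->] /imsetP[b' b'B ->] /imsetP[c' c'A ->] /imsetP[d' d'B ->].
- rewrite !ltn_cyclic_pos_lemb; apply: (ncP A' B') => //.
  by apply: contra neq => /eqP ->.
(* In both mixed cases some left point lies between two right points, which puts it both below [k]
   and at or beyond [k + m.*2]. *)
- case=> /cyclic_pos_lemb_remb ? /cyclic_pos_remb_lemb ? /cyclic_pos_lemb_remb ?.
  by lia.
- case=> /cyclic_pos_remb_lemb ? /cyclic_pos_lemb_remb ? _.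
  by lia.
- rewrite !ltn_cyclic_pos_remb; apply: (ncQ A' B') => //.
  by apply: contra neq => /eqP ->.
Qed.

Lemma noncrossing_tensor_l :
  noncrossing (@cyclic_pos (k + m)) (tensor_blocks P Q) -> noncrossing (@cyclic_pos k) P.
Proof.
move=> nc A B AP BP neq a b c d aA bB cA dB.
rewrite -(ltn_cyclic_pos_lemb m a) -(ltn_cyclic_pos_lemb m b) -(ltn_cyclic_pos_lemb m c).
apply: (nc (lemb m @: A) (lemb m @: B));
  rewrite ?imset_f ?inE ?imset_f //.
by apply: contra neq => /eqP /(imset_inj (@lemb_inj k m)) ->.
Qed.

Lemma noncrossing_tensor_r :
  noncrossing (@cyclic_pos (k + m)) (tensor_blocks P Q) -> noncrossing (@cyclic_pos m) Q.
Proof.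
move=> nc A B AP BP neq a b c d aA bB cA dB.
rewrite -(ltn_cyclic_pos_remb k a) -(ltn_cyclic_pos_remb k b) -(ltn_cyclic_pos_remb k c).
apply: (nc (@remb k m @: A) (@remb k m @: B));
  rewrite ?imset_f ?inE ?imset_f ?orbT //.
by apply: contra neq => /eqP /(imset_inj (@remb_inj k m)) ->.
Qed.

End TensorPlanar.

(** * Planarity under the operations on diagrams *)

Lemma planar_empty : planar empty_diagram.
Proof. by move=> A B; rewrite inE. Qed.

Lemma planar_otimes p q : planar (otimes p q) <-> planar p /\ planar q.
Proof.
split=> [pq|[pp pq]]; last exact: noncrossing_tensor.
by split; [apply: noncrossing_tensor_l pq | apply: noncrossing_tensor_r pq].
Qed.

Lemma planar_bullet p q : planar p -> planar q -> planar (bullet p q).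
Proof.
case: p q => [[|k] P] [[|m] Q] //= pP pQ.
(* k' immediately follows (k+1)' in the cyclic order, so the roles of the two
   merged vertices are exchanged before applying [noncrossing_merge]. *)
rewrite /planar /= merge_blocksC.
apply: noncrossing_merge; last exact: noncrossing_tensor.
- exact: cyclic_pos_inj.
- by rewrite /=; lia.
- exact: tensor_partition.
Qed.

Lemma planar_tensor_seq s :
  planar (tensor_seq s) <-> forall p, p \in s -> planar p.
Proof.
elim: s => [|p s IHs] /=; first by split=> // _; apply: planar_empty.
rewrite planar_otimes IHs; split=> [[pp ps] q|ps].
  by rewrite inE => /predU1P[->|/ps].
by split=> [|q qs]; apply: ps; rewrite inE ?eqxx ?qs ?orbT.
Qed.

Lemma planar_factors p q : planar p -> q \in factors p -> planar q.
Proof.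
(* Only the planarity hypothesis is rewritten, since [p] also occurs in [factors p]. *)
have /andP[_ /eqP {1}<-] := xchooseP (factorization_exists p).
by rewrite planar_tensor_seq => pp; apply: pp.
Qed.

Lemma planar_paddings k s t : (forall p, p \in s -> planar p) -> t \in paddings k s ->
  forall p, p \in t -> planar p.
Proof.
move=> ps; rewrite mem_paddings => /andP[/eqP st _] p pt.
have [->|p0] := eqVneq p empty_diagram; first exact: planar_empty.
by apply: ps; rewrite -st mem_filter p0.
Qed.

Lemma planar_bullet_seq r s : (forall p, p \in r -> planar p) ->
  (forall p, p \in s -> planar p) -> planar (tensor_seq (bullet_seq r s)).
Proof.
move=> pr ps; apply/planar_tensor_seq => _ /mapP[ab + ->].
elim: r s pr ps => [|p r IHr] [|q s] //= pr ps; rewrite inE => /predU1P[->|].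
  by apply: planar_bullet; [apply: pr|apply: ps]; rewrite mem_head.
by apply: IHr => t ts; [apply: pr|apply: ps]; rewrite inE ts orbT.
Qed.

(** * Linear spans and linear extension from a basis *)

Section LinearSpan.
Variables (K : fieldType) (V : lmodType K) (A : V -> Prop).

Lemma linear_span_mem v : A v -> linear_span A v.
Proof.
move=> Av; exists [:: (1, v)]; split; last by rewrite big_seq1 scale1r.
by move=> cu; rewrite inE => /eqP ->.
Qed.

Lemma linear_span0 : linear_span A 0.
Proof. by exists [::]; rewrite big_nil. Qed.

Lemma linear_spanD u v : linear_span A u -> linear_span A v -> linear_span A (u + v).
Proof.
move=> [s [As ->]] [t [At ->]]; exists (s ++ t); rewrite big_cat; split=> // cu.
by rewrite mem_cat => /orP[/As|/At].
Qed.

Lemma linear_spanZ c v : linear_span A v -> linear_span A (c *: v).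
Proof.
move=> [s [As ->]]; exists [seq (c * cu.1, cu.2) | cu <- s]; split.
  by move=> _ /mapP[cu /As Acu ->].
by rewrite big_map scaler_sumr; apply: eq_bigr => cu _; rewrite scalerA.
Qed.

Lemma linear_span_sum (I : eqType) (r : seq I) (P : pred I) (F : I -> V) :
  (forall i, i \in r -> P i -> linear_span A (F i)) ->
  linear_span A (\sum_(i <- r | P i) F i).
Proof.
move=> AF; rewrite big_seq_cond.
apply: big_ind => [|u v|i /andP[]]; [exact: linear_span0|exact: linear_spanD|exact: AF].
Qed.

End LinearSpan.

Section FreegLift.
Variables (K : fieldType) (I : choiceType) (V : lmodType K).
Implicit Types (f : I -> V) (x : {freeg I / K}).

Lemma fgliftE f x : fglift f x = \sum_(i <- dom x) coeff i x *: f i.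
Proof. by rewrite -{1}[x]Freeg_dom fglift_Freeg /prelift big_map. Qed.

Lemma fglift_basis f i : fglift f << i >> = f i.
Proof. by rewrite liftU scale1r. Qed.

Lemma fglift_sum f (J : Type) (r : seq J) (P : pred J) (F : J -> {freeg I / K}) :
  fglift f (\sum_(j <- r | P j) F j) = \sum_(j <- r | P j) fglift f (F j).
Proof.
(* [fB] concerns differences; sums are reached by writing [u + v] as [u - (0 - v)]. *)
have fB := lift_is_additive f; have f0 : fglift f 0 = 0 by rewrite -(subr0 0) fB subrr.
apply: (big_morph _ _ f0) => u v.
by rewrite -[v in LHS]opprK fB -[- v]sub0r fB f0 sub0r opprK.
Qed.

Lemma linear_span_fglift (A : V -> Prop) f x :
  (forall i, i \in dom x -> linear_span A (f i)) -> linear_span A (fglift f x).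
Proof.
move=> Af; rewrite fgliftE; apply: linear_span_sum => i ix _.
by apply: linear_spanZ; apply: Af.
Qed.

End FreegLift.

(** * The planar span: product and antipode *)

Section PlanarSpan.
Variable K : fieldType.
Local Notation H := (@planar_span K).

Lemma freeg_expand (x : ParQSym K) : x = \sum_(p <- dom x) coeff p x *: Mdiag K p.
Proof.
by rewrite -fgliftE -{2}[x]freeg_sumE fglift_sum -{1}[x]freeg_sumE;
  apply: eq_bigr => p _; rewrite liftU; apply/eqP/freeg_eqP => q;
  rewrite coeffZ !coeffU mul1r.
Qed.

Lemma planar_span_Mdiag p : planar p -> H (Mdiag K p).
Proof. by move=> pp; apply: linear_span_mem; exists p. Qed.

(** The support of a combination lies in the union of the supports of its terms. Closure under maps
    defined by [fglift] can thus be checked on planar basis elements. *)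
Lemma planar_span_dom x p : H x -> p \in dom x -> planar p.
Proof.
move=> [s [ps ->]]; rewrite big_seq => /dom_sum_subset/flattenP[_ /mapP[cu + ->]].
rewrite mem_filter => /andP[cus _] /domZ_subset.
by have [q [pq ->]] := ps cu cus; rewrite domU1 inE => /eqP ->.
Qed.

Lemma planar_span_starM p q : planar p -> planar q -> H (starM K p q).
Proof.
move=> pp pq; rewrite /starM; case: ifP => _; first exact: planar_span_Mdiag.
case: ifP => _; first exact: planar_span_Mdiag.
apply: linear_span_sum => k _ _; apply: linear_span_sum => r rp _.
apply: linear_span_sum => s sq _; apply: planar_span_Mdiag; apply: planar_bullet_seq.
  by apply: planar_paddings rp => t; apply: planar_factors.
by apply: planar_paddings sq => t; apply: planar_factors.
Qed.

Lemma planar_span_star x y : H x -> H y -> H (star x y).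
Proof.
move=> Hx Hy; apply: linear_span_fglift => p /(planar_span_dom Hx) pp.
apply: linear_span_fglift => q /(planar_span_dom Hy); exact: planar_span_starM.
Qed.

Lemma star_unit (x : ParQSym K) : star x (unit_elt K) = x.
Proof.
rewrite {2}[x]freeg_expand /star fgliftE; apply: eq_bigr => p _.
by rewrite fglift_basis /starM eqxx; case: eqP => // ->.
Qed.

Lemma tens_Mdiag p q : tens (Mdiag K p) (Mdiag K q) = << (p, q) >>.
Proof. by rewrite /tens !fglift_basis. Qed.

Lemma convolution_Mdiag f g p :
  convolution f g (Mdiag K p) =
    \sum_(qr <- splittings p) star (f (Mdiag K qr.1)) (g (Mdiag K qr.2)).
Proof.
rewrite /convolution /coprod fglift_basis fglift_sum.
by apply: eq_bigr => qr _; rewrite fglift_basis.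
Qed.

Lemma antipode_Mdiag (S : {linear ParQSym K -> ParQSym K}) p : is_antipode S ->
  S (Mdiag K p) = counit (Mdiag K p) *: unit_elt K
    - \sum_(qr <- splittings p | qr != (p, empty_diagram))
        star (S (Mdiag K qr.1)) (Mdiag K qr.2).
Proof.
move=> /(_ (Mdiag K p))[<- _]; rewrite convolution_Mdiag.
(* This splitting occurs exactly once, and its term is [S M_p] times the unit. *)
rewrite (bigD1_seq (p, empty_diagram)) ?splittings_uniq ?mem_splittings ?otimesp0 //=.
by rewrite star_unit addrK.
Qed.

Lemma planar_span_antipode (S : {linear ParQSym K -> ParQSym K}) p : is_antipode S ->
  planar p -> H (S (Mdiag K p)).
Proof.
move=> antiS; have [n] := ubnP (diag_order p).
elim: n p => // n IHn p; rewrite ltnS => le_pn pp.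
rewrite (antipode_Mdiag p antiS) -scaleN1r; apply: linear_spanD.
  by apply: linear_spanZ; apply: planar_span_Mdiag; apply: planar_empty.
apply: linear_spanZ; apply: linear_span_sum => -[q r].
rewrite mem_splittings => /eqP pE; subst p => /= neq.
have [pq pr] := (planar_otimes q r).1 pp.
apply: planar_span_star; last exact: planar_span_Mdiag.
(* [q] has smaller order than [otimes q r]: an empty [r] would give the excluded splitting. *)
apply: IHn => //; apply: leq_trans le_pn; rewrite -[X in (X < _)%N]addn0 ltn_add2l lt0n.
by apply: contra_neq neq => /order0P ->; rewrite otimesp0.
Qed.

End PlanarSpan.

Theorem theorem3p1 (K : fieldType) :
  graded_Hopf_subalgebra (@planar_span K).
Proof.
split.
- split; first exact: linear_span0.
    by move=> c x y Hx Hy; apply: linear_spanD => //; apply: linear_spanZ.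
  move=> i x Hx; apply: linear_span_fglift => p /(planar_span_dom Hx) pp.
  by case: ifP => _; [apply: planar_span_Mdiag|apply: linear_span0].
- split; last exact: planar_span_star.
  by apply: planar_span_Mdiag; apply: planar_empty.
(* For the coproduct, both pieces of each splitting of a planar diagram are planar, so every term is
   a pure tensor of elements of the span. *)
- move=> x Hx; apply: linear_span_fglift => s /(planar_span_dom Hx) ps.
  apply: linear_span_sum => -[p q]; rewrite mem_splittings => /eqP sE _.
  move: ps; rewrite -sE planar_otimes => -[pp pq].
  apply: linear_span_mem; exists (Mdiag K p), (Mdiag K q).
  by rewrite tens_Mdiag; split=> //; apply: planar_span_Mdiag.
- move=> S antiS x Hx; rewrite [x]freeg_expand linear_sum.
  apply: linear_span_sum => p /(planar_span_dom Hx) pp _; rewrite linearZ.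
  by apply: linear_spanZ; apply: planar_span_antipode.
Qed.
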